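(* Let $g\in\mathbb{C}[z_1,\dots,z_n]$ be a nonzero $\Gamma_1$-stable polynomial all of whose monomials have total degrees of the same parity, and let $k_{\max},k_{\min}$ be the maximum and minimum total degree of a monomial of $g$. For each $k$, let $g_k$ be the sum of the terms of $g$ of total degree $k$. Then every $g_k$ is either identically $0$ or $\Gamma_{1/2}$-stable; more precisely, for every $k\in[k_{\min},k_{\max}]$ with $k\equiv k_{\max}\pmod 2$, $g_k$ is $\Gamma_{1/2}$-stable (and in particular not identically zero).
   Context: $\Gamma_\beta=\{\exp(x+iy):x\in\mathbb{R},|y|<\beta\pi/2\}$; $\Gamma_1$ is the open right half-plane. A polynomial is $\Gamma_\beta$-stable if it has no zero with all variables in $\Gamma_\beta$. *)

(* Defs.v *)
From mathcomp Require Import all_boot all_order all_algebra.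
From mathcomp Require Import classical_sets reals sequences exp trigo.
From mathcomp Require Import complex.
(* Without notations and names: they clash with those of mathcomp-analysis. *)
From mathcomp Require Import (canonicals, coercions, hints) mpoly.

Set Implicit Arguments.
Unset Strict Implicit.
Unset Printing Implicit Defensive.

Import Order.TTheory GRing.Theory Num.Theory.

Local Open Scope ring_scope.
Local Open Scope complex_scope.
Local Open Scope classical_set_scope.

(* The complex numbers are R[i], R being any model of the real numbers. *)

Definition cexp (R : realType) (z : R[i]) : R[i] :=
  (expR (complex.Re z) * cos (complex.Im z)) +i*
  (expR (complex.Re z) * sin (complex.Im z)).

Definition sector (R : realType) (beta : R) : set R[i] :=
  [set cexp (x +i* y) | x in [set: R] & y in [set y : R | `|y| < beta * pi / 2]].

Definition stable (R : realType) (n : nat) (D : set R[i])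
    (g : mpoly.mpoly n R[i]) : Prop :=
  forall z : 'I_n -> R[i], (forall i, D (z i)) -> mpoly.meval z g != 0.

Definition max_degree (A : nzRingType) (n : nat) (g : mpoly.mpoly n A) : nat :=
  \max_(m <- mpoly.msupp g) mpoly.mdeg m.

(* Starting the iterated minimum from max_degree g is harmless: for g != 0 this
   is the least total degree of a monomial of g. *)
Definition min_degree (A : nzRingType) (n : nat) (g : mpoly.mpoly n A) : nat :=
  \big[minn/max_degree g]_(m <- mpoly.msupp g) mpoly.mdeg m.

Definition same_parity (A : nzRingType) (n : nat) (g : mpoly.mpoly n A) : Prop :=
  {in mpoly.msupp g &, forall m1 m2, odd (mpoly.mdeg m1) = odd (mpoly.mdeg m2)}.

Definition hcomp (A : nzRingType) (n : nat) (k : nat) (g : mpoly.mpoly n A) :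
    mpoly.mpoly n A :=
  @mpoly.pihomog n A mpoly.mdeg k g.

(* Main.v *)
(* For z in Gamma_{1/2}^n, parity gives g(tz) = t^kmin q(t^2), where q has
   coefficients g_kmin(z), g_{kmin+2}(z), ..., g_kmax(z). If Re s >= 0 and s <> 0,
   then s = t^2 with |arg t| <= pi/4, so tz lies in Gamma_1^n and q(s) <> 0. The
   extreme coefficients g_kmin(z) and g_kmax(z) do not vanish either: these forms
   are limits of rescalings of g, so a zero would persist (Hurwitz) along a line
   through z on which the form is not identically zero. Hence all roots of q lie
   in Re s < 0, by Gauss-Lucas the same holds for all its derivatives, and
   evaluating these at 0 shows that no coefficient of q vanishes. *)

Require Import Defs.
From mathcomp Require Import all_boot all_order all_algebra.
From mathcomp Require Import classical_sets reals sequences exp trigo.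
From mathcomp Require Import complex.
From mathcomp Require Import (canonicals, coercions, hints) mpoly.
From mathcomp Require Import ring lra zify.

Set Implicit Arguments.
Unset Strict Implicit.
Unset Printing Implicit Defensive.

Import Order.TTheory GRing.Theory Num.Theory.

Local Open Scope ring_scope.
Local Open Scope complex_scope.

(** * Persistence of roots under deformation *)

(** Induction on the roots: a new factor ['X - r%:P] turns coefficient [i] into a difference of two
    terms and multiplies the constant one by [r] in norm. As [d <= |r|], each term weighted by
    [d ^+ i] is at most [|r|] times the previous bound, whence one factor 2 per root. *)
Lemma coef_prod_XsubC_le (F : numFieldType) (rs : seq F) (d : F) (i : nat) :
    0 <= d -> all (fun r => d <= `|r|) rs ->
  let p := \prod_(r <- rs) ('X - r%:P) in
  `|p`_i| * d ^+ i <= 2 ^+ size rs * `|p`_0|.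
Proof.
move=> d0; elim: rs i => [|r rs IH] i /=.
  move=> _; rewrite big_nil expr0 mul1r !coef1 eqxx normr1.
  by case: i => [|i]; rewrite /= ?normr1 ?expr0 ?mulr1 // normr0 mul0r.
case/andP=> dr /IH{}IH; rewrite big_cons.
set p := \prod_(_ <- _) _ in IH *.
have -> : `|(('X - r%:P) * p)`_0| = `|r| * `|p`_0|.
  by rewrite mulrBl coefB coefXM coefCM /= sub0r normrN normrM.
have r_ge0 := normr_ge0 r.
have H j : `|r * p`_j| * d ^+ j <= `|r| * (2 ^+ size rs * `|p`_0|).
  by rewrite normrM -mulrA ler_wpM2l.
rewrite mulrBl coefB coefXM coefCM exprS -mulrA.
set B := _ * (`|r| * _).
have eB : `|r| * (2 ^+ size rs * `|p`_0|) = B by rewrite /B mulrCA.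
have B0 : 0 <= B by rewrite -eB !mulr_ge0 ?exprn_ge0 ?ler0n.
have -> : 2 * B = B + B by rewrite mulr_natl mulr2n.
case: i => [|i] /=.
  rewrite sub0r normrN; apply: le_trans (H 0) _.
  by rewrite eB lerDl.
apply: le_trans (_ : (`|p`_i| + `|r * p`_i.+1|) * d ^+ i.+1 <= _).
  by rewrite ler_wpM2r ?exprn_ge0 // ler_normB.
rewrite mulrDl lerD // -?eB //.
rewrite exprS mulrCA; apply: ler_pM => //.
by rewrite mulr_ge0 ?exprn_ge0.
Qed.

Lemma coef_le_of_roots (C : numClosedFieldType) (p : {poly C}) (d : C) (i : nat) :
    0 <= d -> (forall x, root p x -> d <= `|x|) ->
  `|p`_i| * d ^+ i <= 2 ^+ (size p).-1 * `|p`_0|.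
Proof.
move=> d0 proot; have [->|p_neq0] := eqVneq p 0.
  by rewrite !coef0 normr0 mul0r mulr0.
have [rs def_p] := closed_field_poly_normal p.
have lc0 : lead_coef p != 0 by rewrite lead_coef_eq0.
have size_rs : (size p).-1 = size rs.
  by rewrite def_p size_scale // size_prod_XsubC.
have rsd : all (fun r => d <= `|r|) rs.
  by apply/allP => r rsr; apply: proot; rewrite def_p rootZ // root_prod_XsubC.
rewrite size_rs def_p !coefZ !normrM mulrCA -mulrA ler_wpM2l //.
exact: coef_prod_XsubC_le.
Qed.

Lemma horner_sub_coef0_le (F : numDomainType) (q : {poly F}) (e : F) :
  0 <= e <= 1 -> `|q.[e] - q`_0| <= e * \sum_(i < size q) `|q`_i|.
Proof.
case/andP=> e0 e1; elim/poly_ind: q => [|q c _].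
  by rewrite horner0 coef0 subr0 normr0 mulr_ge0 ?sumr_ge0.
rewrite hornerMXaddC coefD coefMX coefC /= add0r addrK mulrC normrM ger0_norm //.
apply: ler_wpM2l => //.
have [-> | q0] := eqVneq q 0; first by rewrite horner0 normr0 sumr_ge0.
rewrite size_MXaddC (negPf q0) /= big_ord_recl horner_coef.
apply: le_trans (ler_norm_sum _ _ _) _.
apply: ler_wpDl => //; apply: ler_sum => j _.
rewrite coefD coefMX coefC /= addr0 normrM ler_piMr // normrX ger0_norm //.
exact: exprn_ile1.
Qed.

(** The outer variable of [P] is the deformation parameter; each coefficient of the deformed
    polynomial is itself a polynomial in it, to which [horner_sub_coef0_le] applies. *)
Lemma coef_horner_polyC (A : comNzRingType) (P : {poly {poly A}}) (e : A) (i : nat) :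
  P.[e%:P]`_i = (\poly_(j < size P) P`_j`_i).[e].
Proof.
rewrite horner_coef horner_poly coef_sum.
by apply: eq_bigr => j _; rewrite -rmorphXn coefMC.
Qed.

Lemma size_horner_polyC (A : idomainType) (P : {poly {poly A}}) (e : A) :
  (size (P.[e%:P])%R <= \max_(j < size P) size (P`_j)%R)%N.
Proof.
rewrite horner_coef (leq_trans (size_sum _ _ _)) //.
apply/bigmax_leqP => j _; rewrite -rmorphXn mulrC mul_polyC.
exact: leq_trans (size_scale_leq _ _) (leq_bigmax _).
Qed.

(* A form of Hurwitz's theorem: with roots all of norm at least d, a polynomial
   has every coefficient controlled by its constant one, which tends to 0 with e
   whereas some other coefficient does not. *)
Lemma root_near_of_deformation (C : numClosedFieldType) (P : {poly {poly C}}) (d : C) :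
    P`_0 != 0 -> root P`_0 0 -> 0 < d ->
  exists2 e : C, 0 < e & exists2 x : C, `|x| < d & root P.[e%:P] x.
Proof.
move=> P0_neq0 /rootP; rewrite horner_coef0 => P0_root d_gt0.
set m := (size P`_0).-1.
have Pm : P`_0`_m != 0 by rewrite -/(lead_coef _) lead_coef_eq0.
pose q i := \poly_(j < size P) P`_j`_i.
have q0 i : (q i)`_0 = P`_0`_i.
  rewrite coef_poly; case: ltnP => // /(nth_default 0) ->.
  by rewrite coef0.
pose S i := \sum_(j < size (q i)) `|(q i)`_j|.
have S_ge0 i : 0 <= S i by apply: sumr_ge0.
(* [D] bounds the size of the deformed polynomial uniformly in the parameter, so that [K] can be
   fixed before [e]. *)
pose D := (\max_(j < size P) size (P`_j)%R)%N.
pose K := S m * d ^+ m + 2 ^+ D * S 0.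
have K_ge0 : 0 <= K by rewrite addr_ge0 ?mulr_ge0 ?exprn_ge0 ?ler0n // ltW.
pose A := `|P`_0`_m| * d ^+ m.
have A_gt0 : 0 < A by rewrite mulr_gt0 ?normr_gt0 // exprn_gt0.
have AK_gt0 : 0 < A + K by apply: ltr_wpDr.
(* This makes [e <= 1] and [e * K < A]. If every root had norm at least [d], the drift of
   coefficient [m] and the bound on it by the constant coefficient would add up to [A <= e * K]. *)
pose e := A / (A + K).
have e_gt0 : 0 < e by apply: divr_gt0.
have e_le1 : e <= 1 by rewrite ler_pdivrMr // mul1r lerDl.
have e01 : 0 <= e <= 1 by rewrite ltW.
exists e => //.
have [rs def_p] := closed_field_poly_normal P.[e%:P].
have [rsd | /allPn[x rsx x_small]] := boolP (all (fun r => d <= `|r|) rs); last first.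
  exists x; last by rewrite def_p /root hornerZ mulf_eq0 -/(root _ _) root_prod_XsubC rsx orbT.
  by rewrite real_ltNge ?normr_real ?gtr0_real.
have [p0|p_neq0] := eqVneq P.[e%:P] 0.
  by exists 0; rewrite ?normr0 // p0 root0.
have H : `|P.[e%:P]`_m| * d ^+ m <= 2 ^+ (size P.[e%:P]).-1 * `|P.[e%:P]`_0|.
  apply: coef_le_of_roots; first exact: ltW.
  move=> x; rewrite def_p rootZ ?lead_coef_eq0 // root_prod_XsubC.
  exact: (allP rsd).
have H0 : `|P.[e%:P]`_0| <= e * S 0.
  have := horner_sub_coef0_le (q 0) e01.
  by rewrite q0 P0_root subr0 -coef_horner_polyC.
have Hm : `|P`_0`_m| <= `|P.[e%:P]`_m| + e * S m.
  have := horner_sub_coef0_le (q m) e01; rewrite q0 -coef_horner_polyC -/(S m) => h.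
  by rewrite -lerBlDl distrC in h *; apply: le_trans h; exact: lerB_dist.
suff : A <= e * K.
  rewrite /e mulrAC ler_pdivlMr // ler_pM2l // gerDr => /(lt_le_trans A_gt0).
  by rewrite ltxx.
rewrite /A; apply: le_trans (ler_wpM2r _ Hm) _; first by rewrite exprn_ge0 // ltW.
rewrite mulrDl /K mulrDr mulrA addrC lerD2l; apply: le_trans H _.
rewrite mulrCA; apply: ler_pM => //; rewrite ?exprn_ge0 ?ler0n //.
rewrite ler_weXn2l ?ler1n // (leq_trans (leq_pred _)) //.
exact: size_horner_polyC.
Qed.

(** * Univariate polynomials without zeros in the closed right half-plane *)

(** The logarithmic derivative is the sum of the [(s - r)^-1], and inversion preserves the sign of
    the real part. *)
Lemma Re_log_deriv_prod_XsubC_gt0 (C : numClosedFieldType) (rs : seq C) (s : C) :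
    rs != [::] -> all (fun r => 0 < 'Re (s - r)) rs ->
  let p := \prod_(r <- rs) ('X - r%:P) in 0 < 'Re (p^`().[s] / p.[s]).
Proof.
case: rs => // r rs _; elim: rs r => [|r' rs IH] r /=.
  rewrite andbT big_seq1 derivXsubC hornerC hornerXsubC div1r ReV => sr.
  rewrite divr_gt0 // exprn_gt0 // normr_gt0.
  by apply: contraTneq sr => ->; rewrite raddf0 ltxx.
case/andP=> sr srs; have /= := IH r' srs.
have {}srs : all (fun r => 0 < 'Re (s - r)) (r' :: rs) by [].
rewrite (big_cons _ _ r); set p := \prod_(_ <- _) _.
have p0 : p.[s] != 0.
  rewrite -[_ == 0]/(root p s) root_prod_XsubC.
  by apply/negP => /(allP srs); rewrite subrr raddf0 ltxx.
have sr0 : s - r != 0 by apply: contraTneq sr => ->; rewrite raddf0 ltxx.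
have -> : (('X - r%:P) * p)^`().[s] / (('X - r%:P) * p).[s]
   = (s - r)^-1 + p^`().[s] / p.[s].
  rewrite derivM derivXsubC mul1r hornerD !hornerM !hornerXsubC.
  by field; rewrite p0 sr0.
move=> H; rewrite raddfD /= addr_gt0 // ReV divr_gt0 // exprn_gt0 // normr_gt0 //.
Qed.

Definition right_half_plane_nonvanishing (C : numClosedFieldType) (p : {poly C}) :=
  forall s, 0 <= 'Re s -> p.[s] != 0.

(* Gauss-Lucas for the open left half plane. *)
Lemma deriv_right_half_plane_nonvanishing (C : numClosedFieldType) (p : {poly C}) :
    (1 < size p)%N -> right_half_plane_nonvanishing p ->
  right_half_plane_nonvanishing p^`().
Proof.
move=> p_gt1 pP s s_ge0.
have [rs def_p] := closed_field_poly_normal p.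
have lc0 : lead_coef p != 0.
  by rewrite lead_coef_eq0 -size_poly_gt0 (ltn_trans _ p_gt1).
have rs0 : rs != [::].
  apply: contraTneq p_gt1 => rs0; move: def_p; rewrite rs0 big_nil => ->.
  by rewrite size_scale // size_poly1.
have srs : all (fun r => 0 < 'Re (s - r)) rs.
  apply/allP => r rsr; rewrite raddfB /= subr_gt0.
  apply: lt_le_trans s_ge0; rewrite real_ltNge ?Creal_Re ?real0 //.
  apply/negP => /pP; rewrite -[_ == 0]/(root p r) def_p rootZ //.
  by rewrite root_prod_XsubC rsr.
have := Re_log_deriv_prod_XsubC_gt0 rs0 srs.
move=> /=; apply: contraTneq; rewrite def_p derivZ hornerZ => /eqP.
by rewrite mulf_eq0 (negPf lc0) => /eqP ->; rewrite mul0r raddf0 ltxx.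
Qed.

Lemma coef_neq0_right_half_plane (C : numClosedFieldType) (p : {poly C}) (i : nat) :
  right_half_plane_nonvanishing p -> (i < size p)%N -> p`_i != 0.
Proof.
elim: i p => [|i IH] p pP i_lt; first by rewrite -horner_coef0 pP // raddf0.
have /IH : right_half_plane_nonvanishing p^`().
  by apply: deriv_right_half_plane_nonvanishing; rewrite ?(leq_ltn_trans _ i_lt).
rewrite coef_deriv mulrn_eq0; apply.
(* The derivative loses only one degree: its coefficient at [d] is [d.+1] times the leading
   coefficient of [p], nonzero in characteristic 0. *)
case size_p: (size p) i_lt => [//|[//|d]] i_lt.
apply: leq_ltn_trans (i_lt : (i <= d)%N) _.
have : lead_coef p != 0 by rewrite lead_coef_eq0 -size_poly_eq0 size_p.
rewrite lead_coefE size_p /= ltnNge; apply: contra => /(nth_default 0).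
by move/eqP; rewrite coef_deriv mulrn_eq0.
Qed.

(** * A point where a nonzero multivariate polynomial does not vanish *)

(** Reduction modulo [N] isolates the lowest digit; cancelling it and dividing by [N] leaves one
    digit fewer. *)
Lemma eq_digits (N n : nat) (a b : 'I_n -> nat) :
    (forall i, a i < N)%N -> (forall i, b i < N)%N ->
    (\sum_(i < n) a i * N ^ i = \sum_(i < n) b i * N ^ i)%N -> a =1 b.
Proof.
elim: n a b => [|n IH] a b aN bN; first by move=> _ [].
rewrite !big_ord_recl !expn0 !muln1.
under eq_bigr do rewrite lift0 expnSr mulnA.
under [in RHS]eq_bigr do rewrite lift0 expnSr mulnA.
rewrite -!big_distrl /= => e.
have a0 := aN ord0; have b0 := bN ord0.
have eq0 : a ord0 = b ord0.
  by rewrite -(modn_small a0) -(modn_small b0) -(modnMDl (\sum_i a (lift ord0 i) * N ^ i)) addnC e addnC modnMDl.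
have N0 : (0 < N)%N by apply: leq_ltn_trans a0.
move/eqP: e; rewrite eq0 eqn_add2l eqn_pmul2r // => /eqP /IH eqS.
move=> i; case: (unliftP ord0 i) => [j|] -> //.
by apply: eqS.
Qed.

Lemma exists_meval_neq0 (C : numClosedFieldType) (n : nat) (f : mpoly.mpoly n C) :
  f != 0 -> exists v : 'I_n -> C, mpoly.meval v f != 0.
Proof.
move=> f0; pose N := mpoly.msize f.
(* Kronecker's substitution *)
pose e (m : mpoly.multinom n) := (\sum_(i < n) m i * N ^ i)%N.
pose p : {poly C} := \sum_(m <- mpoly.msupp f) mpoly.mcoeff m f *: 'X^(e m).
(* All exponents in [f] are below [N], hence are the base-[N] digits of [e m]; no two monomials of
   [f] merge. *)
have e_inj : {in mpoly.msupp f &, injective e}.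
  have lt m i : m \in mpoly.msupp f -> (m i < N)%N.
    move=> /mpoly.msize_mdeg_lt; apply: leq_ltn_trans.
    by rewrite mpoly.mdegE (bigD1 i) //= leq_addr.
  move=> m1 m2 m1f m2f /eq_digits eqm.
  by apply/mpoly.mnmP => i; apply: eqm => j; apply: lt.
have p0 : p != 0.
  set m := mpoly.mlead f; have mf : m \in mpoly.msupp f by exact: mpoly.mlead_supp.
  apply: contraTneq (mf) => p0.
  rewrite mpoly.mcoeff_msupp negbK; apply/eqP.
  have <- : p`_(e m) = mpoly.mcoeff m f; last by rewrite p0 coef0.
  rewrite coef_sum (bigD1_seq m) ?mpoly.msupp_uniq //= coefZ coefXn eqxx mulr1.
  rewrite big_seq_cond big1 ?addr0 // => m' /andP[m'f m'm].
  rewrite coefZ coefXn; case: eqP => [em|]; rewrite ?mulr0 //.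
  by rewrite (e_inj _ _ mf m'f em) eqxx in m'm.
have /closed_nonrootP[x px] := p0.
exists (fun i => x ^+ (N ^ i)); apply: contraNneq px => fx.
rewrite /root -fx mpoly.mevalE horner_sum; apply/eqP/eq_bigr => m _.
rewrite hornerZ hornerXn; congr (_ * _).
rewrite /e expr_sum; apply: eq_bigr => i _; rewrite -exprM mulnC //.
Qed.

(** * Homogeneous components *)

Lemma meval_hcomp (A : comNzRingType) (n k : nat) (z : 'I_n -> A)
    (f : mpoly.mpoly n A) :
  mpoly.meval z (hcomp k f) =
  \sum_(m <- mpoly.msupp f | mpoly.mdeg m == k)
    mpoly.mcoeff m f * \prod_i z i ^+ m i.
Proof.
rewrite /hcomp /mpoly.pihomog raddf_sum /=.
by apply: eq_bigr => m _; rewrite mpoly.mevalZ mpoly.mevalX.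
Qed.

Lemma meval_scale (A : comNzRingType) (n : nat) (t : A) (z : 'I_n -> A)
    (f : mpoly.mpoly n A) :
  mpoly.meval (fun i => t * z i) f =
  \sum_(k < mpoly.msize f) t ^+ k * mpoly.meval z (hcomp k f).
Proof.
rewrite {1}(mpoly.pihomog_partitionE (leqnn (mpoly.msize f))) raddf_sum /=.
apply: eq_bigr => k _; rewrite -[mpoly.pihomog _ _ _]/(hcomp k f) !meval_hcomp.
rewrite mulr_sumr; apply: eq_bigr => m /eqP <-.
rewrite mulrCA mpoly.mdegE expr_sum -big_split /=; congr (_ * _).
by apply: eq_bigr => i _; rewrite exprMn.
Qed.

Lemma hcomp_neq0 (A : nzRingType) (n k : nat) (f : mpoly.mpoly n A) :
  reflect (exists2 m, m \in mpoly.msupp f & mpoly.mdeg m = k) (hcomp k f != 0).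
Proof.
have E m : mpoly.mcoeff m (hcomp k f) =
           if mpoly.mdeg m == k then mpoly.mcoeff m f else 0.
  rewrite /hcomp /mpoly.pihomog raddf_sum /=.
  under eq_bigr do rewrite mpoly.mcoeffZ mpoly.mcoeffX mulr_natr mulrb.
  rewrite -big_mkcondr /= big_mkcond /=.
  have [mf|mf] := boolP (m \in mpoly.msupp f); last first.
    rewrite (mpoly.memN_msupp_eq0 mf) if_same big_seq big1 // => m' m'f.
    by case: andP => // -[_ /eqP em]; rewrite -em m'f in mf.
  rewrite (bigD1_seq m) ?mpoly.msupp_uniq //= eqxx andbT big1 ?addr0 //.
  by move=> m' /negPf ->; rewrite andbF.
apply: (iffP idP) => [fk|[m mf mk]].
  have := mpoly.mlead_supp fk; set m := mpoly.mlead _.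
  rewrite mpoly.mcoeff_msupp E; have [mk fm|_] := eqVneq (mpoly.mdeg m) k; last by rewrite eqxx.
  by exists m; rewrite // mpoly.mcoeff_msupp.
apply: contraTneq mf => fk; rewrite mpoly.mcoeff_msupp negbK.
by have := E m; rewrite fk mpoly.mcoeff0 mk eqxx => <-.
Qed.

(** * Extreme components as limits of rescalings, studied along lines *)

Definition line (A : comNzRingType) (n : nat) (z w : 'I_n -> A)
    (f : mpoly.mpoly n A) : {poly A} :=
  mpoly.mmap polyC (fun i => (z i)%:P + w i *: 'X) f.

Lemma horner_line (A : comNzRingType) (n : nat) (z w : 'I_n -> A)
    (f : mpoly.mpoly n A) (s : A) :
  (line z w f).[s] = mpoly.meval (fun i => z i + s * w i) f.
Proof.
rewrite /line /mpoly.mmap horner_sum mpoly.mevalE; apply: eq_bigr => m _.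
rewrite hornerM hornerC horner_prod; congr (_ * _); apply: eq_bigr => i _.
by rewrite horner_exp hornerD hornerC hornerZ hornerX mulrC.
Qed.

(** [W] dominates every [|w i|] and [M] every inverse of ['Re (z i)], so [|s| < (M * W)^-1] forces
    [|s * w i| < M^-1 <= 'Re (z i)]. The summands 1 keep [W] and [M] positive even for [n = 0]. *)
Lemma right_half_plane_open (C : numClosedFieldType) (n : nat) (z w : 'I_n -> C) :
    (forall i, 0 < 'Re (z i)) ->
  exists2 d : C, 0 < d &
    forall s, `|s| < d -> forall i, 0 < 'Re (z i + s * w i).
Proof.
move=> z_gt0; pose W := 1 + \sum_i `|w i|; pose M := 1 + \sum_i ('Re (z i))^-1.
have W_gt0 : 0 < W by rewrite ltr_pwDl // sumr_ge0.
have invz_gt0 i : 0 < ('Re (z i))^-1 by rewrite invr_gt0.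
have M_gt0 : 0 < M by rewrite ltr_pwDl // sumr_ge0 // => i _; exact: ltW.
exists (M * W)^-1 => [|s s_lt i]; first by rewrite invr_gt0 mulr_gt0.
have wW : `|w i| <= W.
  rewrite /W (bigD1 i) //= addrCA lerDl addr_ge0 ?sumr_ge0 //.
have zM : M^-1 <= 'Re (z i).
  rewrite -[leRHS]invrK lef_pV2 ?posrE //.
  rewrite /M (bigD1 i) //= addrCA lerDl addr_ge0 ?sumr_ge0 // => j _.
  exact: ltW.
rewrite raddfD /=; have sw : `|s * w i| < M^-1.
  rewrite normrM (le_lt_trans (ler_wpM2l (normr_ge0 s) wW)) //.
  by rewrite -ltr_pdivlMr // -invfM.
have Re_sw : `|'Re (s * w i)| <= `|s * w i| by rewrite leif_normC_Re_Creal.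
have := le_lt_trans Re_sw (lt_le_trans sw zM).
rewrite real_ltr_norml ?Creal_Re // => /andP[+ _].
by rewrite -subr_gt0 opprK addrC.
Qed.

(* The weight e singles out degree k: the sum over j below deforms hcomp k f,
   its value at x = 0, along polynomials without zeros in the half-plane. *)
Lemma hcomp_right_half_plane (C : numClosedFieldType) (n k : nat)
    (f : mpoly.mpoly n C) (e : nat -> nat) :
    hcomp k f != 0 ->
    (forall j, hcomp j f != 0 -> (e j == 0)%N = (j == k)) ->
    (forall (x : C) (z : 'I_n -> C), 0 < x -> (forall i, 0 < 'Re (z i)) ->
       \sum_(j < mpoly.msize f) x ^+ e j * mpoly.meval z (hcomp j f) != 0) ->
  forall z : 'I_n -> C, (forall i, 0 < 'Re (z i)) -> mpoly.meval z (hcomp k f) != 0.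
Proof.
move=> fk_neq0 eE f_stable z z_gt0.
have [v fv] := exists_meval_neq0 fk_neq0.
(* The line through [z] reaches [v] at parameter 1, so [hcomp k f] is not identically zero on it. *)
pose w i := v i - z i.
have k_lt : (k < mpoly.msize f)%N.
  by have /hcomp_neq0[m /mpoly.msize_mdeg_lt + <-] := fk_neq0.
pose P := \sum_(j < mpoly.msize f) 'X^(e j) * (line z w (hcomp j f))%:P.
have P0 : P`_0 = line z w (hcomp k f).
  rewrite coef_sum (bigD1 (Ordinal k_lt)) //= big1 => [|j jk].
    have : e k == 0%N by rewrite eE.
    by move/eqP ->; rewrite expr0 mul1r coefC addr0.
  rewrite coefMC coefXn eq_sym.
  have [->|fj] := eqVneq (hcomp j f) 0.
    by rewrite /line (raddf0 (mpoly.mmap _ _)) mulr0.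
  by rewrite eE // -[_ == k]/(j == Ordinal k_lt) (negPf jk) mul0r.
have [d d_gt0 dP] := right_half_plane_open w z_gt0.
apply/negP => /eqP fkz.
have [||x x_gt0 [s sd]] := @root_near_of_deformation _ P d _ _ d_gt0.
- rewrite P0; apply: contraNneq fv => L0.
  have := horner_line z w (hcomp k f) 1; rewrite L0 horner0 => ->.
  by apply/eqP/mpoly.meval_eq => i; rewrite mul1r addrC subrK.
- rewrite P0; apply/rootP; rewrite horner_line -[RHS]fkz.
  apply/mpoly.meval_eq => i.
  by rewrite mul0r addr0.
(* The root [s] is so close to 0 that its point on the line is still in the half-plane, against
   [f_stable]. *)
apply/negP; rewrite /root; have := f_stable x _ x_gt0 (dP s sd).
congr (_ != _); rewrite !horner_sum; apply: eq_bigr => j _.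
by rewrite hornerM hornerXn hornerC -rmorphXn hornerM hornerC horner_line.
Qed.

Lemma bigmin_nat_le (I : eqType) (x : nat) (s : seq I) (F : I -> nat) (j : I) :
  j \in s -> (\big[minn/x]_(i <- s) F i <= F j)%N.
Proof.
elim: s => // i s IH; rewrite inE big_cons geq_min => /orP[/eqP -> | /IH ->].
  by rewrite leqnn.
exact: orbT.
Qed.

Lemma le_max_degree (A : nzRingType) (n k : nat) (f : mpoly.mpoly n A) :
  hcomp k f != 0 -> (k <= max_degree f)%N.
Proof.
by case/hcomp_neq0 => m mf <-; apply: (leq_bigmax_seq (F := mpoly.mdeg) m mf).
Qed.

Lemma min_degree_le (A : nzRingType) (n k : nat) (f : mpoly.mpoly n A) :
  hcomp k f != 0 -> (min_degree f <= k)%N.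
Proof. by case/hcomp_neq0 => m mf <-; apply: bigmin_nat_le. Qed.

Lemma hcomp_max_degree_neq0 (A : nzRingType) (n : nat) (f : mpoly.mpoly n A) :
  f != 0 -> hcomp (max_degree f) f != 0.
Proof.
move=> f0; have lf := mpoly.mlead_supp f0.
apply/hcomp_neq0; exists (mpoly.mlead f) => //.
apply/eqP; rewrite eqn_leq (leq_bigmax_seq (F := mpoly.mdeg) _ lf) //=.
apply/bigmax_leqP_seq => m mf _.
by rewrite -ltnS mpoly.mlead_deg // mpoly.msize_mdeg_lt.
Qed.

Lemma hcomp_min_degree_neq0 (A : nzRingType) (n : nat) (f : mpoly.mpoly n A) :
  f != 0 -> hcomp (min_degree f) f != 0.
Proof.
move=> f0; rewrite /min_degree big_seq; elim/big_ind: _.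
- exact: hcomp_max_degree_neq0.
- by move=> i j fi fj; rewrite /minn; case: ifP.
- by move=> m mf; apply/hcomp_neq0; exists m.
Qed.

Lemma hcomp_parity (A : nzRingType) (n i j : nat) (f : mpoly.mpoly n A) :
  same_parity f -> hcomp i f != 0 -> hcomp j f != 0 -> odd i = odd j.
Proof. by move=> par /hcomp_neq0[m1 ? <-] /hcomp_neq0[m2 ? <-]; apply: par. Qed.

(** With these weights the deformation is [f(x z) / x ^ min_degree f], and scaling by [x > 0]
    preserves the half-plane. Truncated subtraction is harmless, since no nonzero component has
    smaller degree. *)
Lemma hcomp_min_degree_right_half_plane (C : numClosedFieldType) (n : nat)
    (f : mpoly.mpoly n C) (f_neq0 : f != 0)
    (f_stable : forall z : 'I_n -> C, (forall i, 0 < 'Re (z i)) ->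
       mpoly.meval z f != 0) (z : 'I_n -> C) :
  (forall i, 0 < 'Re (z i)) -> mpoly.meval z (hcomp (min_degree f) f) != 0.
Proof.
apply: (@hcomp_right_half_plane _ _ _ _ (fun j => j - min_degree f)%N).
- exact: hcomp_min_degree_neq0.
- by move=> j /min_degree_le; rewrite subn_eq0 eqn_leq => ->; rewrite andbT.
move=> x {}z x_gt0 z_gt0.
have : mpoly.meval (fun i => x * z i) f != 0.
  by apply: f_stable => i; rewrite ReMl ?gtr0_real // mulr_gt0.
rewrite meval_scale; apply: contraNneq => S0; apply/eqP.
rewrite -[RHS](mulr0 (x ^+ min_degree f)) -[in RHS]S0 mulr_sumr.
apply: eq_bigr => j _; rewrite mulrA -exprD.
have [->|fj] := eqVneq (hcomp j f) 0; first by rewrite mpoly.meval0 !mulr0.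
by rewrite subnKC ?min_degree_le.
Qed.

(** Dual to the minimum: the deformation is [x ^ max_degree f] times [f(z / x)]. *)
Lemma hcomp_max_degree_right_half_plane (C : numClosedFieldType) (n : nat)
    (f : mpoly.mpoly n C) (f_neq0 : f != 0)
    (f_stable : forall z : 'I_n -> C, (forall i, 0 < 'Re (z i)) ->
       mpoly.meval z f != 0) (z : 'I_n -> C) :
  (forall i, 0 < 'Re (z i)) -> mpoly.meval z (hcomp (max_degree f) f) != 0.
Proof.
apply: (@hcomp_right_half_plane _ _ _ _ (fun j => max_degree f - j)%N).
- exact: hcomp_max_degree_neq0.
- by move=> j /le_max_degree; rewrite subn_eq0 eqn_leq => ->.
move=> x {}z x_gt0 z_gt0.
have : mpoly.meval (fun i => x^-1 * z i) f != 0.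
  by apply: f_stable => i; rewrite ReMl ?realV ?gtr0_real // mulr_gt0 ?invr_gt0.
rewrite meval_scale; apply: contraNneq => S0; apply/eqP.
rewrite -[RHS](mulr0 (x ^- max_degree f)) -[in RHS]S0 mulr_sumr.
apply: eq_bigr => j _; rewrite mulrA.
have [->|fj] := eqVneq (hcomp j f) 0; first by rewrite mpoly.meval0 !mulr0.
have x0 : x != 0 by rewrite gt_eqF.
rewrite exprVn -{1}(subnKC (le_max_degree fj)) exprD invfM -[_^-1 * _^-1 * _]mulrA.
by rewrite mulVf ?expf_neq0 // mulr1.
Qed.

(** * Intermediate components on the sector of half-angle pi/4 *)

(** Of the two square roots take one with [0 <= 'Re t]. The real part of [t ^+ 2] is the difference
    of the squares of ['Re t] and ['Im t], which gives the last bound; then ['Re t = 0] would force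
    [t = 0]. *)
Lemma sqrt_in_sector (C : numClosedFieldType) (s : C) :
  0 <= 'Re s -> s != 0 ->
  exists t, [/\ t ^+ 2 = s, 0 < 'Re t & `|'Im t| <= 'Re t].
Proof.
move=> s_ge0 s_neq0.
have [t [ts t_ge0]] : exists t, t ^+ 2 = s /\ 0 <= 'Re t.
  have := Creal_Re (sqrtC s); rewrite realE => /orP[h|h].
    by exists (sqrtC s); rewrite sqrtCK.
  by exists (- sqrtC s); rewrite sqrrN sqrtCK raddfN /= oppr_ge0.
have ReIm : `|'Im t| <= 'Re t.
  rewrite -(@ler_pXn2r _ 2) ?nnegrE // real_normK ?Creal_Im //.
  by rewrite -subr_ge0 !expr2 -ReM -expr2 ts.
exists t; split=> //; rewrite lt0r t_ge0 andbT.
apply: contra s_neq0 => /eqP Re0.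
move: ReIm; rewrite Re0 normr_le0 => /eqP Im0.
by rewrite -ts [t]Crect Re0 Im0 mulr0 addr0 expr0n.
Qed.

(** Arguments add: one is at most pi/4 in absolute value and the other strictly less, so the sum
    stays below pi/2. *)
Lemma Re_mul_sector_gt0 (C : numClosedFieldType) (t z : C) :
  0 < 'Re t -> `|'Im t| <= 'Re t -> `|'Im z| < 'Re z -> 0 < 'Re (t * z).
Proof.
move=> t_gt0 t_le z_lt; rewrite ReM subr_gt0.
apply: le_lt_trans (real_ler_norm _) _; first by rewrite rpredM ?Creal_Im.
rewrite normrM; apply: le_lt_trans (ler_wpM2r (normr_ge0 _) t_le) _.
by rewrite ltr_pM2l.
Qed.

Lemma hcomp_sector (C : numClosedFieldType) (n k : nat)
    (f : mpoly.mpoly n C) (z : 'I_n -> C) :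
    f != 0 ->
    (forall z : 'I_n -> C, (forall i, 0 < 'Re (z i)) -> mpoly.meval z f != 0) ->
    same_parity f ->
    (min_degree f <= k <= max_degree f)%N -> odd k = odd (max_degree f) ->
  (forall i, `|'Im (z i)| < 'Re (z i)) -> mpoly.meval z (hcomp k f) != 0.
Proof.
move=> f0 f_stable par /andP[kmin kmax] k_odd z_sector.
set a := min_degree f in kmin *; set b := max_degree f in kmax k_odd *.
have z_gt0 i : 0 < 'Re (z i) by apply: le_lt_trans (z_sector i).
have odd_ab : odd a = odd b.
  exact: hcomp_parity par (hcomp_min_degree_neq0 f0) (hcomp_max_degree_neq0 f0).
pose c j := mpoly.meval z (hcomp j f).
have c0 j : hcomp j f = 0 -> c j = 0 by rewrite /c => ->; rewrite mpoly.meval0.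
have ca : c a != 0 by apply: hcomp_min_degree_right_half_plane.
have cb : c b != 0 by apply: hcomp_max_degree_right_half_plane.
pose d := ((b - a)./2)%N.
have ad : (a + d.*2 = b)%N by rewrite /d; lia.
pose q := \poly_(i < d.+1) c (a + i.*2)%N.
(* The degree is exactly [d] because the top coefficient is [c b], nonzero by [cb]. *)
have size_q : size q = d.+1 by rewrite size_poly_eq // ad.
(* On the ray through z, f is t^a q(t^2). *)
have fq t : mpoly.meval (fun i => t * z i) f = t ^+ a * q.[t ^+ 2].
  have -> : mpoly.meval (fun i => t * z i) f = (\poly_(j < mpoly.msize f) c j).[t].
    by rewrite meval_scale horner_poly; apply: eq_bigr => j _; rewrite mulrC.
  have -> : \poly_(j < mpoly.msize f) c j = 'X^a * (q \Po 'X^2).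
    apply/polyP => j; rewrite coef_poly coefXnM coef_comp_poly_Xn // coef_poly.
    have -> : (if (j < mpoly.msize f)%N then c j else 0) = c j.
      case: ltnP => // j_ge; apply/esym/c0/eqP; apply: contraTT j_ge.
      by case/hcomp_neq0 => m /mpoly.msize_mdeg_lt + <-; rewrite ltnNge.
    (* A nonzero component has degree [j] between [a] and [b] with their parity, so it is entry
       [(j - a) / 2] of [q]. For a zero component both sides vanish. *)
    have [fj|fj] := eqVneq (hcomp j f) 0; last first.
      have := le_max_degree fj; have := min_degree_le fj.
      have := hcomp_parity par fj (hcomp_max_degree_neq0 f0).
      rewrite -/a -/b => j_odd aj jb.
      rewrite ltnNge aj /= dvdn2 oddB // j_odd odd_ab addbb /=.
      have -> : ((j - a) %/ 2 < d.+1)%N by lia.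
      by congr c; lia.
    rewrite c0 //; case: ltnP => // aj; case: ifP => // j_even.
    case: ifP => // _; rewrite c0 //.
    by have -> : (a + ((j - a) %/ 2).*2 = j)%N by lia.
  by rewrite hornerM hornerXn horner_comp hornerXn.
have q_stable : right_half_plane_nonvanishing q.
  (* At [s = 0] the value is [c a], which the stability of [f] at points [t * z] does not reach;
     there [ca] is used. *)
  move=> s s_ge0; have [->|s0] := eqVneq s 0.
    by rewrite horner_coef0 coef_poly addn0.
  have [t [ts t_gt0 t_le]] := sqrt_in_sector s_ge0 s0.
  have : mpoly.meval (fun i => t * z i) f != 0.
    by apply: f_stable => i; exact: Re_mul_sector_gt0.
  by rewrite fq ts mulf_eq0 negb_or => /andP[].
have := @coef_neq0_right_half_plane _ q ((k - a)./2) q_stable.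
rewrite size_q coef_poly.
have -> : ((k - a)./2 < d.+1)%N by rewrite /d; lia.
have -> : (a + (k - a)./2.*2 = k)%N by lia.
exact.
Qed.

(** * Sectors in terms of real and imaginary parts *)

(** Polar form: [y] is the argument of [z] and [a / cos y] its modulus. *)
Lemma right_half_plane_sector (R : realType) (z : R[i]) :
  0 < complex.Re z -> sector 1 z.
Proof.
case: z => a b /= a_gt0; set y := trigo.atan (b / a).
have cy : 0 < cos y by rewrite cos_gt0_pihalf // atan_gtNpi2 atan_ltpi2.
exists (ln (a / cos y)) => //; exists y.
  by rewrite /= mul1r ltr_norml atan_gtNpi2 atan_ltpi2.
rewrite /cexp /= lnK ?posrE ?divr_gt0 // divfK ?gt_eqF //; congr (_ +i* _).
have : tan y = b / a by rewrite atanK.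
rewrite /tan => /(canRL (divfK (lt0r_neq0 cy))) ->.
by field; rewrite !gt_eqF.
Qed.

(** Here [|y| < pi/4], so [cos (2 y) > 0], which says that the square of [sin y] is less than that
    of [cos y]. *)
Lemma sector_half_lt (R : realType) (z : R[i]) :
  sector (1 / 2) z -> `|complex.Im z| < complex.Re z.
Proof.
case=> x _ [y /= y_lt <-] /=.
have pi0 := pi_gt0 R.
move: y_lt; rewrite ltr_norml => /andP[y1 y2].
have cy : 0 < cos y by rewrite cos_gt0_pihalf //; apply/andP; split; lra.
have c2y : 0 < cos (y *+ 2).
  by rewrite cos_gt0_pihalf // (mulr2n y); apply/andP; split; lra.
rewrite normrM ger0_norm ?expR_ge0 // ltr_pM2l ?expR_gt0 //.
rewrite -(@ltr_pXn2r _ 2) ?nnegrE ?(ltW cy) // real_normK ?num_real //.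
by move: c2y; rewrite cos_mulr2n sin2cos2; lra.
Qed.

Theorem theorem5p8 (R : realType) (n : nat) (g : mpoly.mpoly n R[i])
    (g_neq0 : g != 0)
    (g_stable : stable (sector 1) g)
    (g_parity : same_parity g) :
  (forall k : nat, hcomp k g = 0 \/ stable (sector (1 / 2)) (hcomp k g)) /\
  (forall k : nat,
     (min_degree g <= k <= max_degree g)%N ->
     (k = max_degree g %[mod 2])%N ->
     stable (sector (1 / 2)) (hcomp k g) /\ hcomp k g != 0).
Proof.
have g_half_plane (z : 'I_n -> R[i]) :
    (forall i, 0 < 'Re (z i)) -> mpoly.meval z g != 0.
  move=> z_gt0; apply: g_stable => i; apply: right_half_plane_sector.
  (* ['Re] takes its values in [R[i]], [complex.Re] in [R]. *)
  by rewrite -ltcR complexRe.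
have sect (k : nat) : (min_degree g <= k <= max_degree g)%N ->
    odd k = odd (max_degree g) -> stable (sector (1 / 2)) (hcomp k g).
  move=> k_range k_odd z z_sector; apply: hcomp_sector => // i.
  by rewrite -complexRe -complexIm normc_def /= expr0n addr0 sqrtr_sqr ltcR; exact: sector_half_lt.
split=> k.
  have [gk|gk] := eqVneq (hcomp k g) 0; [by left | right; apply: sect].
    by rewrite min_degree_le ?le_max_degree.
  exact: hcomp_parity g_parity gk (hcomp_max_degree_neq0 g_neq0).
move=> k_range k_mod.
have k_stable : stable (sector (1 / 2)) (hcomp k g).
  by apply: sect => //; move: k_mod; rewrite !modn2; do 2 case: odd.
(* The sector contains 1, so the zero polynomial is not stable. *)
have one_sector : sector (1 / 2) (1 : R[i]).
  exists 0 => //; exists 0; rewrite /= ?normr0.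
    by rewrite !mulr_gt0 ?pi_gt0 ?invr_gt0.
  by rewrite /cexp /= expR0 cos0 sin0 mulr1 mulr0.
split=> //; apply: contraNneq (k_stable (fun=> 1) (fun=> one_sector)) => ->.
by rewrite mpoly.meval0.
Qed.
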